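(* Let $H$ be a hypergraph and let $E,F\subseteq E(H)$ be two disjoint collections of hyperedges. Then $E,F$ is an equal partition of vertices if and only if the vector $\alpha=\chi_E-\chi_F$ belongs to the null space of $I_H$.
   Context: A hypergraph $H$ is a pair $(V(H),E(H))$ with $V(H)$ a non-empty finite set (vertices) and $E(H)$ a set of non-empty subsets of $V(H)$ (hyperedges). The vertex-edge incidence matrix $I_H$ has rows indexed by $V(H)$ and columns indexed by $E(H)$, with $(v,e)$ entry equal to $1$ if $v\in e$ and $0$ otherwise (it is the transpose of the edge-vertex incidence matrix). The star of a vertex $v$ is $E_v(H)=\{e\in E(H): v\in e\}$; for $\alpha:E(H)\to\mathbb{C}$, $(I_H\alpha)(v)=\sum_{e\in E_v(H)}\alpha(e)$. For $E\subseteq E(H)$, $\chi_E:E(H)\to\{0,1\}$ is the characteristic function of $E$. A pair $E,F\subseteq E(H)$ with $E\cap F=\emptyset$ is called an equal partition of vertices if $|E_v(H)\cap E|=|E_v(H)\cap F|$ for all $v\in V(H)$. *)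

(* Defs.v *)
From HB Require Import structures.
From mathcomp Require Import all_boot all_order all_algebra.
From mathcomp Require Import reals complex.

Set Implicit Arguments.
Unset Strict Implicit.
Unset Printing Implicit Defensive.

Import GRing.Theory.
Local Open Scope ring_scope.
Local Open Scope complex_scope.

Record hypergraph := Hypergraph {
  vertex : finType;
  edges : {set {set vertex}};
  vertex_nonempty : (0 < #|vertex|)%N;
  edges_nonempty : set0 \notin edges }.

Definition star (H : hypergraph) (v : vertex H) : {set {set vertex H}} :=
  [set e in edges H | v \in e].

Definition equal_partition (H : hypergraph) (E F : {set {set vertex H}}) : Prop :=
  [/\ E \subset edges H, F \subset edges H, [disjoint E & F] &
      forall v : vertex H, #|star v :&: E| = #|star v :&: F|].

(* Rows (resp. columns, and coordinates of vectors indexed by hyperedges) are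
   numbered through [enum_val], a bijection from ['I_#|A|] onto [A]. The complex
   numbers are [R[i]], for [R] any model of the real numbers. *)
Definition incidence_mx (R : realType) (H : hypergraph) :
    'M[R[i]]_(#|vertex H|, #|edges H|) :=
  \matrix_(i, j) ((enum_val i : vertex H) \in (enum_val j : {set vertex H}))%:R.

Definition char_vec (R : realType) (H : hypergraph) (E : {set {set vertex H}}) :
    'cV[R[i]]_#|edges H| :=
  \col_j (enum_val j \in E)%:R.

(* The right kernel of [A], i.e. the column vectors [x] with [A *m x = 0];
   [kermx A] is the left kernel. *)
Definition null_space (K : fieldType) (m n : nat) (A : 'M[K]_(m, n)) :
    {vspace 'cV[K]_n} :=
  lker (linfun (mulmx A : 'cV[K]_n -> 'cV[K]_m)).

(* Main.v *)
Require Import Defs.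
From mathcomp Require Import all_boot all_order all_algebra.
From mathcomp Require Import reals complex.

Import GRing.Theory Num.Theory.
Local Open Scope ring_scope.

(** The incidence matrix turns characteristic vectors into degrees: the row of
    [v] in [I_H chi_E] adds up one unit for each hyperedge of [E] through [v],
    so it is the natural number [#|star v :&: E|] read in the complex field.
    By linearity [chi_E - chi_F] is in the null space exactly when these numbers
    agree for [E] and [F] at every vertex; since the field has characteristic
    zero, equality of their images is equality of the cardinals themselves. *)

Lemma mem_null_space (K : fieldType) (m n : nat) (A : 'M[K]_(m, n))
    (x : 'cV[K]_n) : (x \in null_space A) = (A *m x == 0).
Proof. by rewrite memv_ker lfunE. Qed.

(** The columns are numbered by the hyperedges, so the row of a vertex selects
    the hyperedges through it, which form its star; the vector then keeps those
    lying in [E]. *)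
Lemma incidence_mx_char_vec (R : realType) (H : hypergraph)
    (E : {set {set vertex H}}) (i : 'I_#|vertex H|) :
  (incidence_mx R H *m char_vec R E) i 0
    = #|star (enum_val i : vertex H) :&: E|%:R.
Proof.
rewrite mxE.
under eq_bigr => j _ do rewrite !mxE -natrM mulnb.
rewrite -(big_enum_val
  (fun e : {set vertex H} => ((enum_val i \in e) && (e \in E))%:R)).
rewrite -natr_sum -sum1_card; congr _%:R.
rewrite big_mkcond [RHS]big_mkcond; apply: eq_bigr => e _.
by rewrite !inE; case: (e \in edges H); case: (_ \in e); case: (e \in E).
Qed.

Theorem theorem2p31 (R : realType) (H : hypergraph)
    (E F : {set {set vertex H}})
    (sEH : E \subset edges H) (sFH : F \subset edges H)
    (dEF : [disjoint E & F]) :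
  equal_partition E F <->
  char_vec R E - char_vec R F \in null_space (incidence_mx R H).
Proof.
rewrite mem_null_space mulmxBr subr_eq0; split.
  case=> _ _ _ eqEF; apply/eqP/colP => i.
  by rewrite !incidence_mx_char_vec eqEF.
move=> /eqP/colP eqEF; split=> // v; apply/eqP.
have := eqEF (enum_rank v); rewrite !incidence_mx_char_vec enum_rankK.
by move/eqP; rewrite eqr_nat.
Qed.
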